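(* Let $K\subset\mathbb{R}^2$ be a point-symmetric convex body with $d_{BM}(K,P)\ge 1+\varepsilon$ for a parallelogram $P\subset\mathbb{R}^2$ and some $\varepsilon>0$. Then $$\alpha_1(K)<\sqrt{2}\left(1-\frac{\varepsilon}{10}\right).$$
   Context: A convex body is a compact convex set with nonempty interior. A set $K$ is point-symmetric if $K-z=z-K$ for some $z$. Parallelograms are non-degenerate. The Banach--Mazur distance of convex bodies $K,L\subset\mathbb{R}^n$ is $d_{BM}(K,L)=\inf\{\lambda>0 : t^1+K\subset A(L)\subset t^2+\lambda K,\ A\in GL(\mathbb{R}^n),\ t^1,t^2\in\mathbb{R}^n\}$. For an affine subspace $U$, $P_U$ is the orthogonal projection onto $U$ and $\Phi_U(x)=2P_U(x)-x$ is the reflection across $U$. For convex bodies $K,C\subset\mathbb{R}^2$, $R(K,C)=\inf\{\lambda>0 : K\subset z+\lambda C\text{ for some }z\in\mathbb{R}^2\}$. The first Minkowski chirality is $\alpha_1(K)=\inf\{R(K,\Phi_U(K)) : U\subset\mathbb{R}^2\text{ affine subspace},\ \dim U=1\}$. *)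

(* Defs.v *)
From mathcomp Require Import all_boot all_order all_algebra.
From mathcomp Require Import all_classical all_reals all_analysis.
Import Order.TTheory GRing.Theory Num.Theory.
Import numFieldNormedType.Exports.

Set Implicit Arguments.
Unset Strict Implicit.
Unset Printing Implicit Defensive.

Local Open Scope classical_set_scope.
Local Open Scope ring_scope.

(* Vectors of R^n are row vectors, so GL(R^n) acts by right multiplication by
   unit matrices. The library norm on 'rV[R]_n is the max norm; it is used only
   for the topology. Orthogonality refers to the dot product below. *)

Definition dot (R : realType) (n : nat) (u v : 'rV[R]_n) : R :=
  (u *m v^T) 0 0.

Definition convex_body (R : realType) (n : nat) (K : set 'rV[R]_n) : Prop :=
  [/\ compact K, convex_set (K : set (convex_lmodType 'rV[R]_n)) & K° !=set0].

Definition point_symmetric (R : realType) (n : nat) (K : set 'rV[R]_n) : Prop :=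
  exists z : 'rV[R]_n, [set x - z | x in K] = [set z - x | x in K].

Definition parallelogram (R : realType) (P : set 'rV[R]_2) : Prop :=
  exists a u v : 'rV[R]_2, row_free (col_mx u v) /\
    P = [set a + s *: u + t *: v | s in `[0, 1] & t in `[0, 1]].

Definition homothet (R : realType) (n : nat) (t : 'rV[R]_n) (lambda : R)
    (K : set 'rV[R]_n) : set 'rV[R]_n :=
  [set t + lambda *: x | x in K].

(* The infima are taken in the extended reals, where the infimum of the empty
   set is +oo; for convex bodies they are finite. *)

Definition banach_mazur (R : realType) (n : nat) (K L : set 'rV[R]_n) : \bar R :=
  ereal_inf [set lambda%:E | lambda in
    [set lambda : R | 0 < lambda /\
      exists (A : 'M[R]_n) (t1 t2 : 'rV[R]_n),
        [/\ A \in unitmx,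
            [set t1 + x | x in K] `<=` [set x *m A | x in L] &
            [set x *m A | x in L] `<=` homothet t2 lambda K]]].

Definition affine_subspace (R : realType) (n d : nat) (U : set 'rV[R]_n) : Prop :=
  exists (p : 'rV[R]_n) (W : 'M[R]_n),
    \rank W = d /\ U = [set x | (x - p <= W)%MS].

Definition orth_proj (R : realType) (n : nat) (U : set 'rV[R]_n)
    (x : 'rV[R]_n) : 'rV[R]_n :=
  xget 0 [set y | U y /\ forall w, U w -> dot (x - y) (w - y) = 0].

Definition reflection (R : realType) (n : nat) (U : set 'rV[R]_n)
    (x : 'rV[R]_n) : 'rV[R]_n :=
  2 *: orth_proj U x - x.

Definition circumradius (R : realType) (K C : set 'rV[R]_2) : \bar R :=
  ereal_inf [set lambda%:E | lambda in
    [set lambda : R | 0 < lambda /\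
      exists z : 'rV[R]_2, K `<=` homothet z lambda C]].

Definition alpha1 (R : realType) (K : set 'rV[R]_2) : \bar R :=
  ereal_inf [set circumradius K (reflection U @` K) | U in
    [set U : set 'rV[R]_2 | affine_subspace 1 U]].

Lemma dot_eq0 (R : realType) (n : nat) (u : 'rV[R]_n) :
  dot u u = 0 -> u = 0.
Proof.
rewrite /dot mxE => /eqP; rewrite psumr_eq0; last first.
  by move=> i _; rewrite !mxE -expr2 sqr_ge0.
move=> /allP u0; apply/rowP => i; rewrite mxE.
have := u0 i (mem_index_enum i).
by rewrite !mxE mulf_eq0 orbb => /eqP.
Qed.

Lemma orth_proj_spec (R : realType) (n d : nat) (U : set 'rV[R]_n)
    (x : 'rV[R]_n) : affine_subspace d U ->
  U (orth_proj U x) /\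
  forall w, U w -> dot (x - orth_proj U x) (w - orth_proj U x) = 0.
Proof.
move=> [p [W [_ UE]]].
set Q := [set y | U y /\ forall w, U w -> dot (x - y) (w - y) = 0].
suff [y Qy] : exists y, Q y by exact: (xgetPex 0 (ex_intro _ y Qy)).
have cap0 : (W :&: kermx W^T = 0)%MS.
  apply/eqP/rowV0P => v; rewrite sub_capmx => /andP[/submxP[D vE] /sub_kermxP vk].
  apply: dot_eq0.
  by rewrite /dot {2}vE trmx_mul mulmxA vk mul0mx mxE.
have full : (W + kermx W^T :=: 1%:M)%MS.
  apply/eqmxP; rewrite submx1 sub1mx /row_full.
  have := mxrank_sum_cap W (kermx W^T).
  rewrite cap0 mxrank0 addn0 => ->.
  by rewrite mxrank_ker mxrank_tr; apply/eqP; rewrite subnKC // rank_leq_row.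
have : (x - p <= W + kermx W^T)%MS by rewrite full submx1.
case/sub_addsmxP => -[a b] /= xE.
exists (p + a *m W); rewrite /Q /= UE; split.
  by rewrite /= addrC addKr submxMl.
move=> w /= /submxP[D wE].
have -> : x - (p + a *m W) = b *m kermx W^T.
  by rewrite opprD addrA xE addrC addKr.
have -> : w - (p + a *m W) = (D - a) *m W by rewrite opprD addrA wE mulmxBl.
by rewrite /dot trmx_mul mulmxA -(mulmxA b) mulmx_ker mulmx0 mul0mx mxE.
Qed.

Lemma orth_proj_unique (R : realType) (n d : nat) (U : set 'rV[R]_n)
    (x y : 'rV[R]_n) : affine_subspace d U ->
  U y -> (forall w, U w -> dot (x - y) (w - y) = 0) -> orth_proj U x = y.
Proof.
move=> aU Uy yP; have [Uz zP] := orth_proj_spec x aU.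
move: (orth_proj U x) Uz zP => z Uz zP.
apply/eqP; rewrite -subr_eq0; apply/eqP/dot_eq0.
have -> : dot (z - y) (z - y) = dot (x - y) (z - y) + dot (x - z) (y - z).
  have {1}-> : z - y = (x - y) - (x - z).
    by apply/esym; rewrite opprB addrC addrA subrK.
  by rewrite /dot -[y - z]opprB linearN mulmxN mulmxBl !mxE.
by rewrite yP // zP // addr0.
Qed.

(* Main.v *)
Require Import Defs.
From mathcomp Require Import all_boot all_order all_algebra.
From mathcomp Require Import all_classical all_reals all_analysis.
From mathcomp Require Import ring lra.
Import Order.TTheory GRing.Theory Num.Theory numFieldNormedType.Exports.
Local Open Scope classical_set_scope.
Local Open Scope ring_scope.

Set Implicit Arguments.
Unset Strict Implicit.
Unset Printing Implicit Defensive.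

(* Centre K at 0 and choose a quadratic form q with {q <= m} in K in {q <= 1}
   and m as large as possible. The reflection in an axis of q preserves q, so
   alpha_1(K) <= 1 / sqrt m, and it remains to bound m from below.
   By optimality the inner contact directions u, v and the outer ones p, p'
   alternate. K lies in the parallelogram of the slabs |q(u, x)| <= m and
   |q(v, x)| <= m, and since p, p' lie between the contacts, this forces m >= 1/2
   and puts the corners of the parallelogram, measured in the norm of {q <= m},
   within t of +-p, +-p', where t^2 = 10 (2m - 1)^2 as long as 2m - 1 <= 1/5.
   Hence the parallelogram is contained in (1 + t) K and eps <= t.
   If 2m - 1 > 1/5, the parallelogram circumscribed to {q <= 1} along a
   q-orthonormal basis already gives 1 + eps <= sqrt (2 / m). *)

(** * Quadratic forms and the cross product on the plane *)

Lemma two_ords (P : 'I_2 -> Prop) : P 0 -> P 1 -> forall i, P i.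
Proof.
move=> P0 P1 [[|[|//]]] lt_i2; first by rewrite (_ : Ordinal _ = 0) //; exact/val_inj.
by rewrite (_ : Ordinal _ = 1) //; exact/val_inj.
Qed.

Lemma row2P (R : realType) (x y : 'rV[R]_2) :
  x 0 0 = y 0 0 -> x 0 1 = y 0 1 -> x = y.
Proof. by move=> e0 e1; apply/rowP; apply: two_ords. Qed.

(* A triple [f] encodes the symmetric matrix [[f0, f1], [f1, f2]]. *)
Definition bform (R : realType) (f : 'rV[R]_3) (x y : 'rV[R]_2) : R :=
  f 0 0 * (x 0 0 * y 0 0) + f 0 1 * (x 0 0 * y 0 1 + x 0 1 * y 0 0)
  + f 0 2 * (x 0 1 * y 0 1).

Definition qform (R : realType) (f : 'rV[R]_3) (x : 'rV[R]_2) : R :=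
  bform f x x.

Definition cross (R : realType) (x y : 'rV[R]_2) : R :=
  x 0 0 * y 0 1 - x 0 1 * y 0 0.

Lemma bformC (R : realType) (f : 'rV[R]_3) x y : bform f x y = bform f y x.
Proof. by rewrite /bform; ring. Qed.

Lemma bformDr (R : realType) (f : 'rV[R]_3) x y z :
  bform f x (y + z) = bform f x y + bform f x z.
Proof. by rewrite /bform !mxE; ring. Qed.

Lemma bformZr (R : realType) (f : 'rV[R]_3) k x y :
  bform f x (k *: y) = k * bform f x y.
Proof. by rewrite /bform !mxE; ring. Qed.

Lemma bformNr (R : realType) (f : 'rV[R]_3) x y : bform f x (- y) = - bform f x y.
Proof. by rewrite /bform !mxE; ring. Qed.

Lemma qformZ (R : realType) (f : 'rV[R]_3) k x :
  qform f (k *: x) = k ^+ 2 * qform f x.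
Proof. by rewrite /qform /bform !mxE; ring. Qed.

Lemma qformN (R : realType) (f : 'rV[R]_3) x : qform f (- x) = qform f x.
Proof. by rewrite /qform /bform !mxE; ring. Qed.

Lemma qform_comb (R : realType) (f : 'rV[R]_3) s t x y :
  qform f (s *: x + t *: y) =
  s ^+ 2 * qform f x + t ^+ 2 * qform f y + 2 * s * t * bform f x y.
Proof. by rewrite /qform /bform !mxE; ring. Qed.

Lemma qform_pencil (R : realType) (f g : 'rV[R]_3) t x :
  qform (f + t *: g) x = qform f x + t * qform g x.
Proof. by rewrite /qform /bform !mxE; ring. Qed.

(** * Continuity of these polynomial expressions *)

Lemma continuous_at_add (R : realType) (T : topologicalType) (f g : T -> R) t :
  continuous_at t f -> continuous_at t g ->
  continuous_at t (fun x => f x + g x).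
Proof. by move=> cf cg; exact: cvgD. Qed.

Lemma continuous_at_sub (R : realType) (T : topologicalType) (f g : T -> R) t :
  continuous_at t f -> continuous_at t g ->
  continuous_at t (fun x => f x - g x).
Proof. by move=> cf cg; exact: cvgB. Qed.

Lemma continuous_at_mul (R : realType) (T : topologicalType) (f g : T -> R) t :
  continuous_at t f -> continuous_at t g ->
  continuous_at t (fun x => f x * g x).
Proof. by move=> cf cg; exact: cvgM. Qed.

Ltac polynomial_continuous R :=
  repeat first [exact: coord_continuous | exact: cst_continuous
    | apply: (@continuous_at_sub R) | apply: (@continuous_at_add R)
    | apply: (@continuous_at_mul R)].

Lemma bform_continuous (R : realType) (f : 'rV[R]_3) x : continuous (bform f x).
Proof. by move=> y; rewrite /bform; polynomial_continuous R. Qed.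

Lemma qform_continuous (R : realType) (f : 'rV[R]_3) : continuous (qform f).
Proof. by move=> y; rewrite /qform /bform; polynomial_continuous R. Qed.

Lemma qform_continuousl (R : realType) (x : 'rV[R]_2) :
  continuous (fun f : 'rV[R]_3 => qform f x).
Proof. by move=> f; rewrite /qform /bform; polynomial_continuous R. Qed.

Lemma cross_continuous (R : realType) (x : 'rV[R]_2) : continuous (cross x).
Proof. by move=> y; rewrite /cross; polynomial_continuous R. Qed.

(** * Numerical estimates for an outer contact point between two inner ones *)

(** For p = a u + b v with q(u) = q(v) = m, q(u, v) = m g and q(p) = 1, the numbers [a + g * b] and
    [b + g * a] are q(u, p) / m and q(v, p) / m. Thus [p] almost reaches the edge of the slab of
    [u]. *)
Lemma contact_bound (R : realType) (m a b g : R) :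
  1 <= 2 * m -> 2 * m - 1 <= 5^-1 -> `|g| <= 2 * m - 1 ->
  0 <= a -> -1 <= b + g * a <= 1 ->
  m * (a ^+ 2 + b ^+ 2 + 2 * g * a * b) = 1 ->
  1 - 2 * (2 * m - 1) <= a + g * b.
Proof.
move=> m1 m2 /ler_normlP[g1 g2] a0 /andP[b1 b2] E.
set c := 2 * m - 1 in m1 m2 g1 g2 *.
have mE : m = (1 + c) / 2 by rewrite /c; field.
have c0 : 0 <= c by rewrite /c; lra.
have gc : g ^+ 2 <= c ^+ 2 by nra.
have c2 : c ^+ 2 <= 25^-1 by nra.
have d0 : 0 < 1 - g ^+ 2 by lra.
(* The remaining term [g * s] costs at most another [c]. *)
suff : 1 - c <= a * (1 - g ^+ 2).
  set s := b + g * a in b1 b2 *; move=> H.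
  have -> : a + g * b = a * (1 - g ^+ 2) + g * s by rewrite /s; ring.
  nra.
rewrite -(@ler_pXn2r _ 2%N) ?nnegrE //; [|lra|by apply: mulr_ge0 => //; lra].
have -> : (a * (1 - g ^+ 2)) ^+ 2 =
  (1 - g ^+ 2) * ((a ^+ 2 + b ^+ 2 + 2 * g * a * b) - (b + g * a) ^+ 2) by ring.
set Q := _ + _ + _ in E *.
have Q2 : Q = 2 / (1 + c).
  by rewrite -[Q](@mulfK _ m) ?[Q * m]mulrC ?E ?mE; [field; lra|lra].
have H1 : (b + g * a) ^+ 2 <= 1 by nra.
(* The two factors bound [1 - g ^+ 2] and 1 / m minus a square from below. *)
have -> : (1 - c) ^+ 2 = (1 - c ^+ 2) * (2 / (1 + c) - 1) by field; lra.
rewrite Q2; apply: ler_pM; [lra| |lra|lra].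
by rewrite subr_ge0 ler_pdivlMr; lra.
Qed.

(** Both coordinates of the slab corner in the basis u, v are [(1 + g)^-1], so the left side is q /
    m of the corner minus p. It is rewritten through [e1] and [e2], by which p misses the two
    edges. *)
Lemma slab_vertex_bound (R : realType) (c a b g : R) :
  c <= 5^-1 -> `|g| <= c ->
  1 - 2 * c <= a + g * b <= 1 -> 1 - 2 * c <= b + g * a <= 1 ->
  ((1 + g)^-1 - a) ^+ 2 + ((1 + g)^-1 - b) ^+ 2
    + 2 * g * ((1 + g)^-1 - a) * ((1 + g)^-1 - b) <= 10 * c ^+ 2.
Proof.
move=> m2 /ler_normlP[g1 g2] /andP[a1 a2] /andP[b1 b2].
have c0 : 0 <= c by lra.
set e1 := 1 - (a + g * b); set e2 := 1 - (b + g * a).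
have e1b : 0 <= e1 <= 2 * c by rewrite /e1; apply/andP; split; lra.
have e2b : 0 <= e2 <= 2 * c by rewrite /e2; apply/andP; split; lra.
have -> : ((1 + g)^-1 - a) ^+ 2 + ((1 + g)^-1 - b) ^+ 2
    + 2 * g * ((1 + g)^-1 - a) * ((1 + g)^-1 - b) =
   (e1 ^+ 2 + e2 ^+ 2 - 2 * g * e1 * e2) / (1 - g ^+ 2).
  by rewrite /e1 /e2; field; apply/andP; split; apply/negP => /eqP; nra.
have gc : g ^+ 2 <= c ^+ 2 by nra.
have d0 : 0 < 1 - g ^+ 2 by nra.
rewrite ler_pdivrMr //.
case/andP: e1b => e10 e11; case/andP: e2b => e20 e21.
have e1s : e1 ^+ 2 <= 4 * c ^+ 2 by nra.
have e2s : e2 ^+ 2 <= 4 * c ^+ 2 by nra.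
have e12 : e1 * e2 <= 4 * c ^+ 2 by nra.
have e12' : 0 <= e1 * e2 by nra.
(* The numerator is at most 8 (1 + c) c^2, and 8 (1 + c) <= 10 (1 - c^2) holds exactly up to c =
   1/5; hence the constants 10 and 1/5. *)
have : - 2 * g * (e1 * e2) <= 8 * c * c ^+ 2 by nra.
have c2 : 0 <= c ^+ 2 by nra.
have : c ^+ 2 <= 25^-1 by nra.
set X := e1 * e2 in e12 e12' *.
rewrite -!mulrA -/X.
nra.
Qed.

(** * Centred convex bodies and their boundary *)

Definition centered_body (R : realType) (K : set 'rV[R]_2) : Prop :=
  [/\ compact K, forall x, K x -> K (- x),
      forall x y t, 0 <= t <= 1 -> K x -> K y -> K ((1 - t) *: x + t *: y)
    & K° 0].

Definition boundary (R : realType) (K : set 'rV[R]_2) : set 'rV[R]_2 := K `\` K°.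

Lemma interior_ball (R : realType) (K : set 'rV[R]_2) x :
  K° x <-> exists2 r, 0 < r & forall z, `|z| < r -> K (x + z).
Proof.
split=> [/nbhs_ballP[r r0 rK]|[r r0 rK]].
  exists r => // z zr; apply: rK; rewrite -ball_normE /=.
  by rewrite opprD addrA subrr add0r normrN.
apply/nbhs_ballP; exists r => //= y; rewrite -ball_normE /= => yr.
by have := rK (y - x); rewrite [x + _]addrC subrK distrC; apply.
Qed.

(** The homothety with centre [x] and ratio [t] carries a ball around [y] inside [K] to a ball
    around the combination. *)
Lemma interior_conv (R : realType) (K : set 'rV[R]_2) x y t :
  (forall x y t, 0 <= t <= 1 -> K x -> K y -> K ((1 - t) *: x + t *: y)) ->
  0 < t <= 1 -> K x -> K° y -> K° ((1 - t) *: x + t *: y).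
Proof.
move=> cK /andP[t0 t1] Kx /interior_ball[r r0 rK]; apply/interior_ball.
exists (t * r); first exact: mulr_gt0.
move=> z zr; have -> : (1 - t) *: x + t *: y + z =
    (1 - t) *: x + t *: (y + t^-1 *: z).
  by rewrite scalerDr scalerA divff ?gt_eqF// scale1r addrA.
apply: cK => //; first by rewrite ltW.
by apply: rK; rewrite normrZ gtr0_norm ?invr_gt0// ltr_pdivrMl.
Qed.

Lemma centered_scale (R : realType) (K : set 'rV[R]_2) x t :
  centered_body K -> `|t| <= 1 -> K x -> K (t *: x).
Proof.
move=> [_ sK cK /interior_subset K0].
wlog t0 : t x / 0 <= t => [wl|].
  move=> t1 Kx; have [t0|/ltW t0] := leP 0 t; first exact: wl.
  have -> : t *: x = (- t) *: (- x) by rewrite scalerN scaleNr opprK.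
  by apply: wl; [rewrite oppr_ge0|rewrite normrN|exact: sK].
rewrite (ger0_norm t0) => t1 Kx.
have -> : t *: x = (1 - t) *: 0 + t *: x by rewrite scaler0 add0r.
by apply: cK => //; rewrite t0.
Qed.

Lemma interior_scale (R : realType) (K : set 'rV[R]_2) x t :
  centered_body K -> `|t| < 1 -> K x -> K° (t *: x).
Proof.
move=> [_ sK cK K0].
wlog t0 : t x / 0 <= t => [wl|].
  move=> t1 Kx; have [t0|/ltW t0] := leP 0 t; first exact: wl.
  have -> : t *: x = (- t) *: (- x) by rewrite scalerN scaleNr opprK.
  by apply: wl; [rewrite oppr_ge0|rewrite normrN|exact: sK].
rewrite (ger0_norm t0) => t1 Kx.
have -> : t *: x = (1 - (1 - t)) *: x + (1 - t) *: 0.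
  by rewrite scaler0 addr0 opprB addrC subrK.
by apply: interior_conv => //; rewrite subr_gt0 t1 gerBl.
Qed.

Lemma boundary_compact (R : realType) (K : set 'rV[R]_2) :
  compact K -> compact (boundary K).
Proof.
move=> cK; apply: compact_closedI => //.
by apply: open_closedC; exact: open_interior.
Qed.

Lemma boundaryN (R : realType) (K : set 'rV[R]_2) y :
  centered_body K -> boundary K y -> boundary K (- y).
Proof.
move=> [_ sK _ _] [Ky nKy]; split; first exact: sK.
move=> /interior_ball[r r0 rK]; apply: nKy; apply/interior_ball; exists r => // z zr.
by rewrite -[y + z]opprK opprD; apply/sK/rK; rewrite normrN.
Qed.

Lemma boundary_neq0 (R : realType) (K : set 'rV[R]_2) x :
  centered_body K -> boundary K x -> x != 0.
Proof. by move=> [_ _ _ K0] [_ nx]; apply/eqP => x0; apply: nx; rewrite x0. Qed.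

Lemma cross_colinear (R : realType) (x y : 'rV[R]_2) :
  x != 0 -> cross x y = 0 -> exists t, y = t *: x.
Proof.
move=> x0 xy.
have [x00|x00] := eqVneq (x 0 0) 0; last first.
  exists (y 0 0 / x 0 0); apply: row2P; rewrite !mxE ?divfK //.
  apply: (mulfI x00); rewrite mulrAC mulrCA divff // mulr1.
  by apply/eqP; rewrite -subr_eq0 mulrC [y 0 0 * _]mulrC; move: xy;
    rewrite /cross mulrC => ->.
have x01 : x 0 1 != 0.
  by apply: contra x0 => /eqP x01; apply/eqP/row2P; rewrite mxE.
exists (y 0 1 / x 0 1); apply: row2P; rewrite !mxE ?divfK //.
apply: (mulfI x01); rewrite x00 !mulr0.
by move: xy; rewrite /cross x00 mul0r sub0r => /eqP; rewrite oppr_eq0 => /eqP.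
Qed.

(** The boundary point is the last point of [K] on the line through [x] in the direction of [x]; it
    exists by compactness. *)
Lemma boundary_on_ray (R : realType) (K : set 'rV[R]_2) x :
  centered_body K -> x != 0 ->
  exists s, [/\ 0 < s, boundary K (s *: x) & ~ K x -> s < 1].
Proof.
move=> bK x0; have [cK sK vK K0] := bK.
(* The identity matrix, so [bform f] is the Euclidean inner product. *)
set f := \row_(i < 3) (i != 1)%:R : 'rV[R]_3.
have fE y : bform f x y = x 0 0 * y 0 0 + x 0 1 * y 0 1.
  by rewrite /bform !mxE /=; ring.
have xx0 : 0 < bform f x x.
  rewrite fE lt_neqAle eq_sym addr_ge0 -?expr2 ?sqr_ge0 // andbT.
  apply: contra x0; rewrite paddr_eq0 ?sqr_ge0 // !sqrf_eq0.
  by move=> /andP[/eqP e0 /eqP e1]; apply/eqP/row2P; rewrite mxE.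
have cL : compact (K `&` [set y | cross x y = 0]).
  apply: compact_closedI => //.
  apply: (@preimage_closed _ _ (cross x) [set 0]); last exact: closed_eq.
  by move=> y _; exact: cross_continuous.
have [|y yL ymax] := compact_EVT_max _ cL (continuous_subspaceT (@bform_continuous R f x)).
  by exists 0; split; [exact: interior_subset|rewrite /= /cross !mxE; ring].
move: yL; rewrite inE => -[Ky xy].
have [s yE] := cross_colinear x0 xy.
move/interior_ball: (K0) => [r r0 rK].
have nx0 : 0 < `|x| by rewrite normr_gt0.
have small e : 0 < e -> exists2 d, 0 < d & `|d *: x| < e.
  move=> e0; exists (e / (2 * `|x|)); first by rewrite divr_gt0 ?mulr_gt0.
  rewrite normrZ gtr0_norm ?divr_gt0 ?mulr_gt0 // invfM mulrA divfK ?gt_eqF//.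
  by lra.
have crx t : cross x (t *: x) = 0 by rewrite /cross !mxE; ring.
have s0 : 0 < s.
  have [d d0 dr] := small r r0.
  have := ymax (d *: x); rewrite inE /= => /(_ (conj _ (crx d))) -H.
  have : d * bform f x x <= s * bform f x x.
    by rewrite -!bformZr -yE; apply: H; rewrite -[_ *: _]add0r; exact: rK.
  by rewrite ler_pM2r //; exact: lt_le_trans.
exists s; split => //.
  rewrite -yE; split => // /interior_ball[e e0 eK].
  have [d d0 de] := small e e0.
  have := ymax ((s + d) *: x); rewrite inE /= => /(_ (conj _ (crx _))) -H.
  have : (s + d) * bform f x x <= s * bform f x x.
    by rewrite -!bformZr -yE; apply: H; rewrite scalerDl -yE; exact: eK.
  by rewrite ler_pM2r // gerDl leNgt d0.
move=> nKx; rewrite ltNge; apply/negP => s1; apply: nKx.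
have -> : x = s^-1 *: y by rewrite yE scalerA mulVf ?gt_eqF// scale1r.
by apply: centered_scale; rewrite // gtr0_norm ?invr_gt0// invf_le1.
Qed.

(** * Forms squeezing a body, and an optimal one *)

(** Where [G] is negative nothing is to be checked beyond [F x <= c]. On the compact rest, [F] keeps
    a positive distance from [c] and [G] is bounded. *)
Lemma perturb_below_max (R : realType) (T : topologicalType) (A : set T)
    (F G : T -> R) (c : R) :
  compact A -> continuous F -> continuous G ->
  (forall x, A x -> F x <= c) -> (forall x, A x -> F x = c -> G x < 0) ->
  exists2 t0, 0 < t0 & forall t, 0 < t < t0 -> forall x, A x -> F x + t * G x < c.
Proof.
move=> cA cF cG Fc FG.
have [A0|A0] := pselect (A `&` [set x | 0 <= G x] !=set0); last first.
  exists 1 => // t /andP[t0 _] x Ax.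
  have : G x < 0 by rewrite ltNge; apply/negP => Gx; apply: A0; exists x.
  by move=> Gx; have := Fc x Ax; nra.
have cA' : compact (A `&` [set x | 0 <= G x]).
  apply: compact_closedI => //.
  apply: (@preimage_closed _ _ G [set r | 0 <= r]); last exact: closed_ge.
  by move=> y _; exact: cG.
have [x0 + Fmax] := compact_EVT_max A0 cA' (continuous_subspaceT cF).
have [x1 + Gmax] := compact_EVT_max A0 cA' (continuous_subspaceT cG).
rewrite !inE => -[Ax1 /= Gx1] [Ax0 /= Gx0].
have d0 : 0 < c - F x0.
  rewrite subr_gt0 lt_neqAle Fc // andbT; apply/eqP => /FG.
  by move=> /(_ Ax0); rewrite ltNge Gx0.
(* The [+ 1] covers the case [G x1 = 0]. *)
exists ((c - F x0) / (G x1 + 1)); first by apply: divr_gt0 => //; lra.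
move=> t /andP[t0]; rewrite ltr_pdivlMr; last lra.
move=> tlt x Ax; have [Gx|Gx] := ltP (G x) 0; first by have := Fc x Ax; nra.
have := Fmax x; have := Gmax x; rewrite !inE => /(_ (conj Ax Gx)) ? /(_ (conj Ax Gx)) ?.
have : t * G x <= t * G x1 by rewrite ler_pM2l.
nra.
Qed.

(** For a centred body and [m > 0] this gives {q <= m} in K in {q <= 1}. The inner inclusion is
    imposed on the boundary, and definiteness is relaxed to semidefiniteness, so that every
    condition is closed in [(f, m)]. *)
Definition squeezes (R : realType) (K : set 'rV[R]_2) (f : 'rV[R]_3) (m : R) :=
  [/\ forall x, K x -> qform f x <= 1, forall x, 0 <= qform f x
    & forall y, boundary K y -> m <= qform f y].

(** Scaling [x] to the boundary yields definiteness from the boundary bound alone; this is how a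
    perturbed form is later seen to be nonnegative. *)
Lemma squeezes_gt0 (R : realType) (K : set 'rV[R]_2) f m x :
  centered_body K -> 0 < m -> (forall y, boundary K y -> m <= qform f y) ->
  x != 0 -> 0 < qform f x.
Proof.
move=> bK m0 fm x0; have [s [s0 /fm + _]] := boundary_on_ray bK x0.
by rewrite qformZ => /(lt_le_trans m0); rewrite pmulr_rgt0 // exprn_gt0.
Qed.

(** A point outside [K] lies beyond the boundary point on its ray, where q is already at least
    [m]. *)
Lemma squeezes_sub (R : realType) (K : set 'rV[R]_2) f m x :
  centered_body K -> 0 < m -> squeezes K f m -> qform f x <= m -> K x.
Proof.
move=> bK m0 [_ _ fm] qx; apply: contrapT => nKx.
have x0 : x != 0.
  by apply/eqP => x0; apply: nKx; rewrite x0; case: bK => _ _ _ /interior_subset.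
have [s [s0 /fm + /(_ nKx) s1]] := boundary_on_ray bK x0.
rewrite qformZ; have := squeezes_gt0 bK m0 fm x0.
have : s ^+ 2 < 1 by rewrite expr_lt1 // ltW.
nra.
Qed.

Lemma boundary_nonempty (R : realType) (K : set 'rV[R]_2) :
  centered_body K -> boundary K !=set0.
Proof.
move=> bK; have /(boundary_on_ray bK)[s [_ bs _]] : (const_mx 1 : 'rV[R]_2) != 0.
  by apply/eqP => /rowP/(_ 0); rewrite !mxE => /eqP; rewrite oner_eq0.
by exists (s *: const_mx 1).
Qed.

Lemma squeezes_closed (R : realType) (K : set 'rV[R]_2) :
  closed [set p : 'rV[R]_3 * R | squeezes K p.1 p.2].
Proof.
have c1 x : continuous (fun p : 'rV[R]_3 * R => qform p.1 x).
  move=> p; apply: (@continuous_comp _ _ _ fst (fun f => qform f x)).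
    exact: cvg_fst.
  exact: qform_continuousl.
have -> : [set p : 'rV[R]_3 * R | squeezes K p.1 p.2] =
  \bigcap_(x in K) ((fun p => qform p.1 x) @^-1` [set r | r <= 1]) `&`
  (\bigcap_(x in setT) ((fun p => qform p.1 x) @^-1` [set r | 0 <= r]) `&`
  \bigcap_(x in boundary K) ((fun p => qform p.1 x - p.2) @^-1` [set r | 0 <= r])).
  apply/seteqP; split=> p /=.
    move=> [p1 p2 p3]; split; [|split] => y Ky /=; [exact: p1|exact: p2|].
    by rewrite subr_ge0; exact: p3.
  move=> [p1 [p2 p3]]; split=> [y /p1//|y|y /p3 /=]; first exact: p2.
  by rewrite subr_ge0.
apply: closedI; last apply: closedI; apply: closed_bigI => x _;
  apply: preimage_closed => [p _|]; try exact: c1.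
- exact: closed_le.
- exact: closed_ge.
- apply: continuous_at_sub; first exact: c1.
  exact: cvg_snd.
- exact: closed_ge.
Qed.

(** The values of q at (1,0), (0,1) and (1,1) determine the coefficients. Scaled by a fixed [e],
    these vectors lie in [K], where q is between 0 and 1. *)
Lemma squeezes_bounded (R : realType) (K : set 'rV[R]_2) :
  centered_body K ->
  exists C, forall f m, squeezes K f m -> forall i, - C <= f 0 i <= C.
Proof.
move=> [_ _ _ /interior_ball[r r0 rK]].
pose v a b : 'rV[R]_2 := \row_i (if i == 0 then a else b).
pose N := `|v 1 0| + `|v 0 1| + `|v 1 1| + 1.
have N0 : 0 < N by rewrite ltr_wpDl // !addr_ge0.
set e := r / (2 * N).
have e0 : 0 < e by rewrite divr_gt0 // mulr_gt0.
have Ke x : `|x| <= N -> K (e *: x).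
  move=> xN; rewrite -[_ *: _]add0r; apply: rK; rewrite normrZ gtr0_norm //.
  apply: (@le_lt_trans _ _ (e * N)); first by rewrite ler_pM2l.
  rewrite /e invfM mulrA mulfVK ?gt_eqF //; lra.
exists ((e ^+ 2)^-1) => f m [f1 f0 _].
have q1 x : `|x| <= N -> 0 <= qform f x <= (e ^+ 2)^-1.
  move=> xN; rewrite f0 /= -[leRHS]mul1r ler_pdivlMr ?exprn_gt0 // mulrC.
  by rewrite -qformZ; exact/f1/Ke.
have := q1 (v 1 0); have := q1 (v 0 1); have := q1 (v 1 1).
have n0 := normr_ge0 (v 1 0); have n1 := normr_ge0 (v 0 1).
have n2 := normr_ge0 (v 1 1).
rewrite /N /qform /bform !mxE /= => /(_ ltac:(lra)) /andP[h1 h2].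
move=> /(_ ltac:(lra)) /andP[h3 h4] /(_ ltac:(lra)) /andP[h5 h6].
set C := (e ^+ 2)^-1 in h2 h4 h6 *.
move=> [[|[|[|//]]] lti].
- by rewrite (_ : Ordinal _ = 0); [apply/andP; split; lra|exact/val_inj].
- by rewrite (_ : Ordinal _ = 1); [apply/andP; split; lra|exact/val_inj].
- by rewrite (_ : Ordinal _ = 2); [apply/andP; split; lra|exact/val_inj].
Qed.

(** The Euclidean form, scaled to stay below 1 on [K], has a positive minimum on the compact
    boundary. *)
Lemma squeezes_witness (R : realType) (K : set 'rV[R]_2) :
  centered_body K -> exists f m, 0 < m /\ squeezes K f m.
Proof.
move=> bK; have [cK _ _ K0] := bK; have [y by_] := boundary_nonempty bK.
pose f : 'rV[R]_3 := \row_i (i != 1)%:R.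
have fE x : qform f x = x 0 0 ^+ 2 + x 0 1 ^+ 2.
  by rewrite /qform /bform !mxE /=; ring.
have f0 x : 0 <= qform f x by rewrite fE addr_ge0 // sqr_ge0.
have cf := @qform_continuous R f.
have [|M _ Mmax] := compact_EVT_max _ cK (continuous_subspaceT cf).
  by exists y; case: by_.
have [|y0 + mmin] := compact_EVT_min _ (boundary_compact cK) (continuous_subspaceT cf).
  by exists y.
rewrite inE => by0.
have m0 : 0 < qform f y0.
  rewrite lt_neqAle f0 andbT eq_sym; apply: contra (boundary_neq0 bK by0).
  rewrite fE paddr_eq0 ?sqr_ge0 // !sqrf_eq0 => /andP[/eqP e0 /eqP e1].
  by apply/eqP/row2P; rewrite mxE.
set c := (qform f M + 1)^-1.
have c0 : 0 < c by rewrite invr_gt0 ltr_wpDl.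
have cE x : qform (c *: f) x = c * qform f x.
  by rewrite /qform /bform !mxE; ring.
exists (c *: f), (c * qform f y0); split; first exact: mulr_gt0.
split=> x; rewrite !cE.
- move=> Kx; rewrite /c mulrC ler_pdivrMr ?ltr_wpDl // mul1r.
  by apply: ler_wpDr => //; apply: Mmax; rewrite inE.
- by rewrite mulr_ge0 // ltW.
- by move=> bx; rewrite ler_pM2l //; apply: mmin; rewrite inE.
Qed.

Lemma squeezes_le1 (R : realType) (K : set 'rV[R]_2) f m :
  centered_body K -> squeezes K f m -> m <= 1.
Proof.
move=> bK [f1 _ fm]; have [y by_] := boundary_nonempty bK.
by apply: le_trans (fm y by_) (f1 y _); case: by_.
Qed.

(** The pairs with [m] in [0, 1] form a compact set, on which [m] attains its maximum; the witness
    makes that maximum positive. *)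
Lemma optimal_squeeze (R : realType) (K : set 'rV[R]_2) :
  centered_body K -> exists f m, [/\ 0 < m, squeezes K f m &
    forall f' m', squeezes K f' m' -> m' <= m].
Proof.
move=> bK; have [C fC] := squeezes_bounded bK.
have [f0 [m0 [m0_gt0 sf0]]] := squeezes_witness bK.
pose T : set ('rV[R]_3 * R) := ([set v : 'rV[R]_3 | forall i, `[- C, C]%classic (v 0 i)] `*` `[0, 1]%classic)
  `&` [set p | squeezes K p.1 p.2].
have cT : compact T.
  apply: compact_closedI; last exact: squeezes_closed.
  apply: compact_setX; last exact: segment_compact.
  exact: (@rV_compact R 3 (fun=> `[- C, C]%classic) (fun=> @segment_compact _ _ _)).
have inT f m : 0 <= m -> squeezes K f m -> (f, m) \in T.
  move=> m_ge0 sfm; rewrite inE; split => //; split => /=.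
    by move=> i; rewrite /= in_itv /=; exact: fC sfm i.
  by rewrite in_itv /= m_ge0; exact: squeezes_le1 sfm.
have [|[f m] + mmax] := compact_EVT_max _ cT (continuous_subspaceT (fun p => @cvg_snd _ _ _ _ _)).
  by exists (f0, m0); rewrite -in_setE; exact: inT (ltW m0_gt0) sf0.
rewrite inE => -[_ /= sfm].
have mm f' m' : 0 <= m' -> squeezes K f' m' -> m' <= m.
  by move=> m'0 sf'; exact: (mmax (f', m') (inT _ _ m'0 sf')).
have m_gt0 : 0 < m by apply: (lt_le_trans m0_gt0); exact: mm (ltW m0_gt0) sf0.
exists f, m; split => // f' m'; have [m'0|m'0 _] := leP 0 m'; first exact: mm.
by rewrite ltW // (lt_trans m'0).
Qed.

(** A small multiple of [g] added to [f] lowers the form at the outer contacts and raises it at the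
    inner ones. By compactness the new form still squeezes [K], with a boundary minimum [m'] above
    [m]. *)
Lemma optimal_no_separation (R : realType) (K : set 'rV[R]_2) f m g :
  centered_body K -> 0 < m -> squeezes K f m ->
  (forall f' m', squeezes K f' m' -> m' <= m) ->
  (forall x, K x -> qform f x = 1 -> qform g x < 0) ->
  (forall y, boundary K y -> qform f y = m -> 0 < qform g y) -> False.
Proof.
move=> bK m0 [f1 f0 fm] opt gX gY; have [cK _ _ _] := bK.
have [t1 t1_gt0 t1P] := perturb_below_max cK (@qform_continuous R f)
  (@qform_continuous R g) f1 gX.
have NE (h : 'rV[R]_3) x : qform (- h) x = - qform h x.
  by rewrite /qform /bform !mxE; ring.
have [||t2 t2_gt0 t2P] := @perturb_below_max _ _ _ _ _ (- m) (boundary_compact cK)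
  (@qform_continuous R (- f)) (@qform_continuous R (- g)).
- by move=> x bx; rewrite NE lerN2; exact: fm.
- by move=> x bx; rewrite !NE oppr_lt0 => /oppr_inj; exact: gY.
pose t := Num.min t1 t2 / 2.
have mt : 0 < Num.min t1 t2 by rewrite lt_min t1_gt0.
have t0 : 0 < t by rewrite divr_gt0.
have tlt1 : t < t1.
  by rewrite ltr_pdivrMr // (@le_lt_trans _ _ t1) ?ge_min ?lexx // ltr_pMr // ltr1n.
have tlt2 : t < t2.
  by rewrite ltr_pdivrMr // (@le_lt_trans _ _ t2) ?ge_min ?lexx ?orbT // ltr_pMr // ltr1n.
have [y0 + ymin] := compact_EVT_min (boundary_nonempty bK) (boundary_compact cK)
  (continuous_subspaceT (@qform_continuous R (f + t *: g))).
rewrite inE => by0; set m' := qform _ y0 in ymin.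
have mm' : m < m'.
  have := t2P t; rewrite t0 tlt2 => /(_ isT y0 by0).
  by rewrite /m' qform_pencil !NE mulrN -opprD ltrN2.
have m'P y : boundary K y -> m' <= qform (f + t *: g) y.
  by move=> by_; apply: ymin; rewrite inE.
suff /opt : squeezes K (f + t *: g) m' by rewrite leNgt mm'.
split=> [x Kx|x|//].
  by rewrite qform_pencil ltW // t1P // t0.
have [->|x0] := eqVneq x 0; first by rewrite /qform /bform !mxE !(mul0r, mulr0, addr0).
by rewrite ltW //; exact: squeezes_gt0 bK (lt_trans m0 mm') m'P x0.
Qed.

(** * Contact points of an optimal form *)

(** The tangent at [y] to the ellipse {q <= m} supports [K]: if [x] were beyond it, the line from
    [x] through [y] would enter the ellipse after [y], and [y] would lie between [x] and an interior
    point [z]. *)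
Lemma inner_contact_slab (R : realType) (K : set 'rV[R]_2) f m y x :
  centered_body K -> 0 < m -> squeezes K f m ->
  boundary K y -> qform f y = m -> K x -> bform f y x <= m.
Proof.
move=> bK m0 sf [_ nKy] qy Kx; rewrite leNgt; apply/negP => bm.
have [cK sK vK K0] := bK; have [f1 f0 fm] := sf.
set d := bform f y x - m; have d0 : 0 < d by rewrite subr_gt0.
have d1 : 0 < 1 + d by rewrite addr_gt0.
(* This value is below 1, so [z] lies past [y], and below [d], so q(z) < m. *)
set s := d / (1 + d).
have s0 : 0 < s by exact: divr_gt0.
have s1 : s < 1 by rewrite /s ltr_pdivrMr // mul1r ltrDr.
have sd : s < d by rewrite /s ltr_pdivrMr // mulrDr mulr1 ltrDl mulr_gt0.
apply: nKy.
set z := (1 - s)^-1 *: (1 *: y + (- s) *: x).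
have s1' : 1 - s != 0 by rewrite subr_eq0 eq_sym lt_eqF.
have -> : y = (1 - (1 - s)) *: x + (1 - s) *: z.
  rewrite /z scalerA divff // !scale1r (_ : 1 - (1 - s) = s); last by ring.
  by rewrite scaleNr [RHS]addrC subrK.
apply: (interior_conv vK _ Kx); first by rewrite subr_gt0 s1 gerBl ltW.
have qz : qform f z < m.
  rewrite /z qformZ qform_comb qy exprVn mulrC ltr_pdivrMr ?exprn_gt0 ?subr_gt0 //.
  have -> : bform f y x = d + m by rewrite /d subrK.
  by have := f1 x Kx; have := f0 x; nra.
set a := qform f z / m.
have a0 : 0 <= a by rewrite divr_ge0 // ltW.
have a1 : a < 1 by rewrite ltr_pdivrMr // mul1r.
(* Here [t < 1] and [t ^+ 2 >= a], so z / t is still in the ellipse; no square root of [a] is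
   required. *)
set t := (1 + a) / 2.
have t0 : 0 < t by rewrite /t; lra.
have -> : z = t *: (t^-1 *: z) by rewrite scalerA divff ?gt_eqF // scale1r.
apply: interior_scale => //; first by rewrite gtr0_norm // /t; lra.
apply: (squeezes_sub bK m0 sf).
rewrite qformZ exprVn mulrC ler_pdivrMr ?exprn_gt0 //.
have -> : qform f z = a * m by rewrite /a divfK ?gt_eqF.
have : a <= t ^+ 2 by rewrite /t; nra.
by move=> at2; rewrite mulrC ler_pM2l.
Qed.

(** This turns a comparison of the slopes q(x, y) / cross x y and q(x, z) / cross x z into the sign
    of [cross y z]. *)
Lemma cross_bform (R : realType) (f : 'rV[R]_3) x y z :
  bform f x y * cross x z - bform f x z * cross x y = qform f x * cross y z.
Proof. by rewrite /qform /bform /cross; ring. Qed.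

Lemma cross_plucker (R : realType) (w x y z : 'rV[R]_2) :
  cross w x * cross y z - cross w y * cross x z + cross w z * cross x y = 0.
Proof. by rewrite /cross; ring. Qed.

Lemma crossNr (R : realType) (x y : 'rV[R]_2) : cross x (- y) = - cross x y.
Proof. by rewrite /cross !mxE; ring. Qed.

Lemma crossNl (R : realType) (x y : 'rV[R]_2) : cross (- x) y = - cross x y.
Proof. by rewrite /cross !mxE; ring. Qed.

Lemma crossC (R : realType) (x y : 'rV[R]_2) : cross x y = - cross y x.
Proof. by rewrite /cross; ring. Qed.

Lemma cross_basis (R : realType) (x y z : 'rV[R]_2) :
  cross x y != 0 ->
  z = (cross z y / cross x y) *: x + (cross x z / cross x y) *: y.
Proof. by move=> h; apply: row2P; rewrite !mxE; move: h; rewrite /cross => h; field. Qed.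

(** The sign makes the form nonnegative on the double wedge where [cross x y] and [cross x z] have
    opposite signs. *)
Lemma cross_product_form (R : realType) (y z : 'rV[R]_2) :
  exists g : 'rV[R]_3, forall x, qform g x = - (cross x y * cross x z).
Proof.
exists (\row_i (if i == 0 then - (y 0 1 * z 0 1)
  else if i == 1 then (y 0 1 * z 0 0 + y 0 0 * z 0 1) / 2 else - (y 0 0 * z 0 0))).
by move=> x; rewrite /qform /bform /cross !mxE /=; field.
Qed.

(* With the direction of [x] at infinity, the slopes of the points of [Y] fill
   a compact set; [y0] and [y1] realise its ends. *)
Lemma extreme_directions (R : realType) (Y : set 'rV[R]_2) f x :
  compact Y -> Y !=set0 -> 0 < qform f x -> (forall y, Y y -> 0 < cross x y) ->
  exists y0 y1, [/\ Y y0, Y y1 & forall y, Y y -> 0 <= cross y y0 /\ cross y y1 <= 0].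
Proof.
move=> cY Y0 qx Yx.
pose s y := bform f x y / cross x y.
have cs : {within Y, continuous s}.
  apply: continuous_in_subspaceT => y; rewrite inE => Yy.
  apply: continuous_at_mul; first exact: bform_continuous.
  by apply: continuousV; [rewrite gt_eqF // Yx|exact: cross_continuous].
have [y0 + ymin] := compact_EVT_min Y0 cY cs.
have [y1 + ymax] := compact_EVT_max Y0 cY cs.
rewrite !inE => Y1 Yy0; exists y0, y1; split => // y Yy.
have := ymin y; have := ymax y; rewrite !inE /s => /(_ Yy) h1 /(_ Yy) h0.
move: h0 h1; rewrite !ler_pdivrMr ?Yx //.
rewrite ![_ / _ * _]mulrAC !ler_pdivlMr ?Yx // => h0 h1.
(* By [cross_bform], the difference of two slopes has the sign of a cross product. *)
split; first by rewrite -(pmulr_rge0 _ qx) -cross_bform subr_ge0.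
by rewrite -(pmulr_rle0 _ qx) -cross_bform subr_le0.
Qed.

(* The contact directions with the two ellipses alternate: otherwise a product
   of two linear forms would separate them, and the pencil it spans with [f]
   would contain a better form. *)
Lemma alternating_contacts (R : realType) (K : set 'rV[R]_2) f m :
  centered_body K -> 0 < m < 1 -> squeezes K f m ->
  (forall f' m', squeezes K f' m' -> m' <= m) ->
  exists u v p q,
   [/\ cross u v != 0, boundary K u /\ qform f u = m, boundary K v /\ qform f v = m,
       K p /\ qform f p = 1 /\
         (exists a b, [/\ 0 < a, 0 < b & p = a *: u + b *: v]) &
       K q /\ qform f q = 1 /\
         (exists a b, [/\ 0 < a, 0 < b & q = a *: u + b *: (- v)])].
Proof.
move=> bK /andP[m0 m1] sf opt; have [cK sK _ _] := bK; have [f1 f0 fm] := sf.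
pose X := K `&` [set x | qform f x = 1].
pose Y := boundary K `&` [set y | qform f y = m].
have noS g : (forall x, X x -> qform g x < 0) -> (forall y, Y y -> 0 < qform g y) -> False.
  move=> gX gY; apply: (optimal_no_separation (g := g) bK m0 sf opt).
    by move=> x Kx qx; apply: gX.
  by move=> y Ky qy; apply: gY.
have clq r : closed [set x | qform f x = r].
  apply: (@preimage_closed _ _ (qform f) [set r]); last exact: closed_eq.
  by move=> y _; exact: qform_continuous.
have cX : compact X by exact: compact_closedI.
have cY : compact Y by apply: compact_closedI => //; exact: boundary_compact.
have NY y : Y y -> Y (- y).
  by move=> [by_ qy]; split; [exact: boundaryN|rewrite /= qformN].
have [x0 [Kx0 qx0]] : X !=set0.
  apply: contrapT => X0; apply: (noS f) => [x Xx|y [_ ->] //].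
  by exfalso; apply: X0; exists x.
have [w Yw] : Y !=set0.
  apply: contrapT => Y0; apply: (noS (- f)) => [x [_ /= qx]|y Yy].
    have -> : qform (- f) x = - qform f x by rewrite /qform /bform !mxE; ring.
    by rewrite qx oppr_lt0.
  by exfalso; apply: Y0; exists y.
(* Since [m < 1], an inner contact in the direction of an outer one would be interior to [K]. *)
have XY x y : X x -> Y y -> cross x y != 0.
  move=> [Kx /= qx] [[_ nKy] /= qy]; apply/eqP => /cross_colinear [].
    apply/eqP => x_0; move: qx; rewrite x_0 /qform /bform !mxE !(mul0r, mulr0, addr0).
    by move/eqP; rewrite eq_sym oner_eq0.
  move=> t yE; apply: nKy; rewrite yE; apply: interior_scale => //.
  rewrite -(@ltr_pXn2r _ 2) ?nnegrE // expr1n real_normK ?num_real //.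
  by move: qy; rewrite yE qformZ qx mulr1 => ->.
(* One representative of each pair of opposite inner contacts, all strictly on one side of the line
   through [x0]. *)
pose Y' := Y `&` [set y | 0 <= cross x0 y].
have cY' : compact Y'.
  apply: compact_closedI => //.
  apply: (@preimage_closed _ _ (cross x0) [set r | 0 <= r]); last exact: closed_ge.
  by move=> y _; exact: cross_continuous.
have signY y : Y y -> Y' y \/ Y' (- y).
  move=> Yy; have [h|h] := leP 0 (cross x0 y); [left|right]; split => //.
    exact: NY.
  by rewrite /= crossNr oppr_ge0 ltW.
have Y'0 : Y' !=set0 by case: (signY w Yw) => ?; [exists w|exists (- w)].
have Y'pos y : Y' y -> 0 < cross x0 y.
  by move=> [Yy /= h]; rewrite lt_neqAle h andbT eq_sym XY.
have qx0_gt0 : 0 < qform f x0 by rewrite qx0.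
have [y0 [y1 [Yy0 Yy1 ext]]] := extreme_directions cY' Y'0 qx0_gt0 Y'pos.
have D0 := Y'pos _ Yy0; have D1 := Y'pos _ Yy1.
have [g gE] := cross_product_form y0 y1.
have gY y : Y y -> 0 <= qform g y.
  by move=> /signY[] /ext; rewrite gE ?crossNl; nra.
(* Otherwise [g] is negative on [X] and nonnegative on [Y], and a small positive multiple of [f]
   makes the separation strict. *)
have [x [Xx gx]] : exists x, X x /\ 0 <= qform g x.
  apply: contrapT => nX.
  have [|x1 + xmax] := compact_EVT_max _ cX (continuous_subspaceT (@qform_continuous R g)).
    by exists x0.
  rewrite inE => Xx1.
  have g1 : qform g x1 < 0.
    by rewrite ltNge; apply/negP => h; apply: nX; exists x1.
  apply: (noS (g + (- qform g x1 / 2) *: f)) => [x Xx|y Yy]; rewrite qform_pencil.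
    have [_ /= ->] := Xx; have := xmax x; rewrite inE => /(_ Xx); lra.
  have [_ /= ->] := Yy; have := gY y Yy; nra.
wlog Dx : x Xx gx / 0 <= cross x0 x.
  move=> wl; have [|h] := leP 0 (cross x0 x); first exact: wl.
  apply: (wl (- x)); last by rewrite crossNr oppr_ge0 ltW.
    by case: Xx => Kx qx; split; [exact: sK|rewrite /= qformN].
  by rewrite qformN.
move: gx; rewrite gE oppr_ge0 => prod.
have n0 := XY _ _ Xx Yy0.1; have n1 := XY _ _ Xx Yy1.1.
have prod_lt0 : cross x y0 * cross x y1 < 0.
  by rewrite lt_neqAle prod andbT mulf_neq0.
have y01 : cross y0 y1 <= 0 by have [] := ext y0 Yy0.
have Dx_gt0 : 0 < cross x0 x.
  rewrite lt_neqAle Dx andbT eq_sym; apply/eqP => Dx0.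
  have := cross_plucker x0 x y0 y1; rewrite Dx0 mul0r sub0r.
  by move: prod_lt0; nra.
have pl := cross_plucker x0 x y0 y1.
have h1 : cross x y1 < 0 by nra.
have h0 : 0 < cross x y0 by nra.
have y01_lt0 : cross y0 y1 < 0 by nra.
(* Counterclockwise from [x0] come [y1], [x], [y0], [- x0], [- y1]. *)
exists y0, y1, x, (- x0).
have [bY0 qY0] := Yy0.1; have [bY1 qY1] := Yy1.1; have [Kx qx] := Xx.
split; [by rewrite lt_eqF|by []|by []|split => //; split => //|split].
  exists (cross x y1 / cross y0 y1), (cross y0 x / cross y0 y1); split.
  - by rewrite -mulrNN mulr_gt0 ?oppr_gt0 ?invr_lt0 // -oppr_lt0 opprK.
  - by rewrite crossC -mulrNN opprK mulr_gt0 // oppr_gt0 invr_lt0.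
  - by apply: cross_basis; rewrite lt_eqF.
  exact: sK.
split; first by rewrite qformN.
exists (- (cross x0 y1 / cross y0 y1)), (cross y0 x0 / cross y0 y1); split.
- by rewrite -mulrN mulr_gt0 // oppr_gt0 invr_lt0.
- by rewrite crossC -mulrNN opprK mulr_gt0 // oppr_gt0 invr_lt0.
- by rewrite scalerN scaleNr -opprD -cross_basis // lt_eqF.
Qed.

(** * Reflections and the bound on [alpha1] *)

Lemma dot2E (R : realType) (u v : 'rV[R]_2) :
  dot u v = u 0 0 * v 0 0 + u 0 1 * v 0 1.
Proof.
by rewrite /dot mxE !big_ord_recl big_ord0 addr0 !mxE (_ : lift ord0 ord0 = 1) //;
  exact/val_inj.
Qed.

Lemma dot_gt0 (R : realType) (d : 'rV[R]_2) : d != 0 -> 0 < dot d d.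
Proof.
move=> d0; rewrite lt_neqAle eq_sym dot2E addr_ge0 -?expr2 ?sqr_ge0 // andbT.
apply: contra d0; rewrite paddr_eq0 ?sqr_ge0 // !sqrf_eq0.
by move=> /andP[/eqP e0 /eqP e1]; apply/eqP/row2P; rewrite mxE.
Qed.

Definition mirror (R : realType) (d x : 'rV[R]_2) : 'rV[R]_2 :=
  (2 * dot x d / dot d d) *: d - x.

Lemma mirrorK (R : realType) (d x : 'rV[R]_2) : d != 0 -> mirror d (mirror d x) = x.
Proof.
move=> /dot_gt0 d0; rewrite /mirror.
have -> : dot ((2 * dot x d / dot d d) *: d - x) d = dot x d.
  have -> : dot ((2 * dot x d / dot d d) *: d - x) d =
     (2 * dot x d / dot d d) * dot d d - dot x d.
    by rewrite !dot2E !mxE; ring.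
  by rewrite divfK ?gt_eqF //; ring.
by rewrite opprB addrC subrK.
Qed.

(** The vector [d] is an eigenvector of the symmetric matrix [f], so its Euclidean orthogonal is
    also its q-orthogonal and the reflection preserves q. *)
Lemma qform_axis (R : realType) (f : 'rV[R]_3) :
  exists2 d, d != 0 & forall x, qform f (mirror d x) = qform f x.
Proof.
pose vec (a b : R) : 'rV[R]_2 := \row_i (if i == 0 then a else b).
(* The equation says that [d] and its image under the matrix have zero cross product. *)
suff [d d0 dE] : exists2 d : 'rV[R]_2, d != 0 &
    f 0 1 * (d 0 0 ^+ 2 - d 0 1 ^+ 2) = (f 0 0 - f 0 2) * d 0 0 * d 0 1.
  exists d => // x; have dd := dot_gt0 d0.
  have key : dot d d * bform f d x = dot x d * qform f d.
    apply/eqP; rewrite -subr_eq0; apply/eqP.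
    have -> : dot d d * bform f d x - dot x d * qform f d = cross d x *
      (f 0 1 * (d 0 0 ^+ 2 - d 0 1 ^+ 2) - (f 0 0 - f 0 2) * d 0 0 * d 0 1).
      by rewrite !dot2E /cross /qform /bform; ring.
    by rewrite dE subrr mulr0.
  set k := 2 * dot x d / dot d d.
  have -> : qform f (mirror d x) = k * (k * qform f d - 2 * bform f d x) + qform f x.
    by rewrite /mirror -/k /qform /bform !mxE; ring.
  have -> : k * qform f d = 2 * bform f d x.
    by rewrite /k mulrAC -[2 * _ * qform f d]mulrA -key; field; rewrite lt0r_neq0.
  by rewrite subrr mulr0 add0r.
have [f1|f1] := eqVneq (f 0 1) 0.
  exists (vec 1 0); last by rewrite !mxE /= f1 mul0r mulr0.
  by apply/eqP => /rowP/(_ 0); rewrite !mxE /= => /eqP; rewrite oner_eq0.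
pose k := (f 0 0 - f 0 2) / 2; pose r := Num.sqrt (k ^+ 2 + f 0 1 ^+ 2).
have r2 : r ^+ 2 = k ^+ 2 + f 0 1 ^+ 2 by rewrite sqr_sqrtr // addr_ge0 ?sqr_ge0.
(* An eigenvector for the larger eigenvalue, half the trace plus [r]. *)
exists (vec (f 0 1) (r - k)).
  by apply/eqP => /rowP/(_ 0); rewrite !mxE /= => /eqP; rewrite (negPf f1).
rewrite !mxE /=; have -> : f 0 0 - f 0 2 = 2 * k by rewrite /k; field.
suff : f 0 1 ^+ 2 - (r - k) ^+ 2 - 2 * k * (r - k) = 0.
  move=> h; apply/eqP; rewrite -subr_eq0; apply/eqP.
  by rewrite -(mulr0 (f 0 1)) -h; ring.
have -> : f 0 1 ^+ 2 - (r - k) ^+ 2 - 2 * k * (r - k) =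
  k ^+ 2 + f 0 1 ^+ 2 - r ^+ 2 by ring.
by rewrite r2 subrr.
Qed.

Lemma reflection_line (R : realType) (z d x : 'rV[R]_2) : d != 0 ->
  reflection [set y | (y - z <= genmx d)%MS] (z + x) = z + mirror d x.
Proof.
move=> d0; have dd := dot_gt0 d0.
have aU : affine_subspace 1 [set y : 'rV[R]_2 | (y - z <= genmx d)%MS].
  by exists z; exists (genmx d); split => //; rewrite mxrank_gen rank_rV d0.
set k := dot x d / dot d d.
rewrite /reflection (orth_proj_unique (y := z + k *: d) aU).
- rewrite /mirror -/k scalerDr scalerA opprD addrACA; congr (_ + _).
    by rewrite scaler_nat mulr2n addrK.
  by congr (_ *: _ - _); rewrite /k mulrA.
- by rewrite /= addrC addKr genmxE; apply/sub_rVP; exists k.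
move=> w /=; rewrite genmxE => /sub_rVP[t wE].
have -> : w - (z + k *: d) = (t - k) *: d by rewrite opprD addrA wE scalerBl.
have -> : z + x - (z + k *: d) = x - k *: d by rewrite opprD addrACA subrr add0r.
have -> : dot (x - k *: d) ((t - k) *: d) = (t - k) * (dot x d - k * dot d d).
  by rewrite !dot2E !mxE; ring.
by rewrite /k divfK ?gt_eqF // subrr mulr0.
Qed.

(** The reflected body still contains {q <= m} around [z], while [K] lies in {q <= 1}, the same
    ellipse enlarged by 1 / sqrt m. *)
Lemma alpha1_le (R : realType) (K : set 'rV[R]_2) z f m :
  centered_body [set x | K (z + x)] -> 0 < m ->
  squeezes [set x | K (z + x)] f m ->
  (alpha1 K <= (Num.sqrt m^-1)%:E)%E.
Proof.
move=> bK m0 sf; have [d d0 df] := qform_axis f.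
set r := Num.sqrt m^-1; have r0 : 0 < r by rewrite sqrtr_gt0 invr_gt0.
pose U := [set y : 'rV[R]_2 | (y - z <= genmx d)%MS].
apply: (@le_trans _ _ (circumradius K (reflection U @` K))).
  apply: ereal_inf_lbound; exists U => //.
  by exists z; exists (genmx d); split => //; rewrite mxrank_gen rank_rV d0.
apply: ereal_inf_lbound; exists r => //; split => //.
(* [homothet] scales about the origin; this translation makes [z] the centre of the dilation. *)
exists (z - r *: z) => x Kx.
pose y := mirror d (r^-1 *: (x - z)).
have Ky : K (z + y).
  apply: (squeezes_sub bK m0 sf (x := y)).
  rewrite /y df qformZ exprVn sqr_sqrtr; last by rewrite invr_ge0 ltW.
  rewrite invrK -[leRHS]mulr1 ler_pM2l //.
  by have [f1 _ _] := sf; apply: f1; rewrite /= addrC subrK.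
exists (z + mirror d y); first by exists (z + y) => //; exact: reflection_line.
rewrite /y mirrorK // scalerDr scalerA divff ?gt_eqF // scale1r addrA subrK.
by rewrite addrC subrK.
Qed.

(** * Banach-Mazur bounds from circumscribed parallelograms *)

Lemma col_mx_unit (R : realType) (u v : 'rV[R]_2) :
  cross u v != 0 -> (col_mx u v : 'M[R]_2) \in unitmx.
Proof.
move=> uv; rewrite -row_free_unit; apply: inj_row_free => x xM.
have e0 : (0 : 'I_2) = lshift 1 (0 : 'I_1) by exact/val_inj.
have e1 : (1 : 'I_2) = rshift 1 (0 : 'I_1) by exact/val_inj.
have c0 j : (col_mx u v : 'M[R]_2) 0 j = u 0 j by rewrite {1}e0; exact: col_mxEu.
have c1 j : (col_mx u v : 'M[R]_2) 1 j = v 0 j by rewrite {1}e1; exact: col_mxEd.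
have xE j : x 0 0 * u 0 j + x 0 1 * v 0 j = 0.
  move/rowP: xM => /(_ j); rewrite !mxE !big_ord_recl big_ord0 addr0.
  by rewrite (_ : lift ord0 ord0 = 1) ?c0 ?c1 //; exact/val_inj.
apply: row2P; rewrite mxE; apply: (mulIf uv); rewrite mul0r /cross.
  transitivity ((x 0 0 * u 0 0 + x 0 1 * v 0 0) * v 0 1
    - (x 0 0 * u 0 1 + x 0 1 * v 0 1) * v 0 0); first ring.
  by rewrite !xE !mul0r subrr.
transitivity ((x 0 0 * u 0 1 + x 0 1 * v 0 1) * u 0 0
    - (x 0 0 * u 0 0 + x 0 1 * v 0 0) * u 0 1); first ring.
by rewrite !xE !mul0r subrr.
Qed.

(** With S the parallelogram of half-sides [w1], [w2] centred at 0, the hypotheses say K - z in S in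
    lambda (K - z). A linear map [A] carries [P] to a translate of S. *)
Lemma banach_mazur_le (R : realType) (K P : set 'rV[R]_2) z w1 w2 (lambda c : R) :
  parallelogram P -> (c%:E <= banach_mazur K P)%E ->
  cross w1 w2 != 0 -> 0 < lambda ->
  (forall x, K (z + x) -> exists s t,
     [/\ `|s| <= 1, `|t| <= 1 & x = s *: w1 + t *: w2]) ->
  (forall s t, `|s| <= 1 -> `|t| <= 1 ->
     K (z + lambda^-1 *: (s *: w1 + t *: w2))) ->
  c <= lambda.
Proof.
move=> [a [u [v [uv ->]]]] bm w12 l0 KS SK.
rewrite -lee_fin; apply: (le_trans bm); apply: ereal_inf_lbound; exists lambda => //.
split => //.
have uvU : (col_mx u v : 'M[R]_2) \in unitmx by rewrite -row_free_unit.
pose W : 'M[R]_2 := col_mx (2 *: w1) (2 *: w2).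
pose M : 'M[R]_2 := col_mx u v.
pose A : 'M[R]_2 := invmx M *m W.
have MA : M *m A = W by rewrite /A mulKVmx.
have [uA vA] : u *m A = 2 *: w1 /\ v *m A = 2 *: w2.
  have : col_mx (u *m A) (v *m A) = col_mx (2 *: w1) (2 *: w2).
    by rewrite -mul_col_mx; exact: MA.
  exact: eq_col_mx.
(* The vector [a *m A + w1 + w2] is the centre of the image of [P]. *)
exists A, (a *m A + w1 + w2 - z), (a *m A + w1 + w2 - lambda *: z); split.
- rewrite /A unitmx_mul unitmx_inv uvU /=; apply: col_mx_unit.
  have -> : cross (2 *: w1) (2 *: w2) = 4 * cross w1 w2.
    by rewrite /cross !mxE; ring.
  by rewrite mulf_neq0.
- move=> _ [x Kx <-]; have [|s [t [s1 t1 xE]]] := KS (x - z).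
    by rewrite addrC subrK.
  exists (a + ((1 + s) / 2) *: u + ((1 + t) / 2) *: v).
    exists ((1 + s) / 2); last exists ((1 + t) / 2) => //.
      by move: s1; rewrite ler_norml /= ?in_itv /= => /andP[? ?]; apply/andP; split; lra.
    by move: t1; rewrite ler_norml /= ?in_itv /= => /andP[? ?]; apply/andP; split; lra.
  rewrite !mulmxDl -!scalemxAl uA vA !scalerA !divfK // !scalerDl !scale1r.
  rewrite -[x in RHS](subrK z) xE; apply/rowP => i; rewrite !mxE; ring.
- move=> _ [_ [s s1 [t t1 <-]] <-].
  pose y := (2 * s - 1) *: w1 + (2 * t - 1) *: w2.
  exists (z + lambda^-1 *: y).
    by apply: SK; move: s1 t1; rewrite /= ?in_itv /= => /andP[? ?] /andP[? ?];
      rewrite ler_norml; apply/andP; split; lra.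
  rewrite scalerDr scalerA divff ?gt_eqF // scale1r /y.
  rewrite !mulmxDl -!scalemxAl uA vA; apply/rowP => i; rewrite !mxE; ring.
Qed.

(** * Centring the body, and symmetric convex combinations *)

Lemma convex_body_centered (R : realType) (K : set 'rV[R]_2) :
  convex_body K -> point_symmetric K ->
  exists z, centered_body [set x | K (z + x)].
Proof.
move=> [cK vK [p Kp]] [z sK]; exists z.
have sK' x : K (z + x) -> K (z - x).
  move=> Kx; have : [set z - y | y in K] (- x).
    by exists (z + x) => //; rewrite opprD addrA subrr add0r.
  by rewrite -sK => -[y Ky yE]; rewrite -yE addrC subrK.
have vK' x y t : 0 <= t <= 1 -> K x -> K y -> K ((1 - t) *: x + t *: y).
  move=> /andP[t0 t1] Kx Ky.
  have := vK y x (Itv01 t0 t1); rewrite !inE /conv /= /unstable.onem addrC; exact.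
have bv x y t : 0 <= t <= 1 -> K (z + x) -> K (z + y) ->
    K (z + ((1 - t) *: x + t *: y)).
  move=> t01 Kx Ky; have := vK' _ _ _ t01 Kx Ky; congr K.
  by apply/rowP => i; rewrite !mxE; ring.
have ip : [set x | K (z + x)]° (p - z).
  move/interior_ball: Kp => [r r0 rK]; apply/interior_ball; exists r => // y yr /=.
  by rewrite addrA [z + _]addrC subrK; exact: rK.
split; [|by move=> x; exact: sK'|by move=> x y t; exact: bv|].
- have -> : [set x | K (z + x)] = [set x - z | x in K].
    apply/seteqP; split => x /=.
      by move=> Kx; exists (z + x) => //; rewrite addrC addKr.
    by move=> [y Ky <-]; rewrite addrC subrK.
  apply: continuous_compact => //; apply: continuous_subspaceT => x.
  apply: (@continuousB R 'rV[R]_2 'rV[R]_2 id (cst z) x); first exact: cvg_id.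
  exact: cst_continuous.
(* The origin is the midpoint of an interior point and its opposite. *)
- have -> : 0 = (1 - 2^-1) *: (- (p - z)) + 2^-1 *: (p - z) :> 'rV[R]_2.
    by apply/rowP => i; rewrite !mxE; field.
  apply: interior_conv => //=; first by apply/andP; split; lra.
  by apply: sK'; rewrite addrC subrK; exact: interior_subset.
Qed.

Lemma centered_comb (R : realType) (K : set 'rV[R]_2) x y a b :
  centered_body K -> `|a| + `|b| <= 1 -> K x -> K y -> K (a *: x + b *: y).
Proof.
move=> bK; have [_ sK vK _] := bK.
wlog a0 : a x / 0 <= a => [wl ab Kx Ky|].
  have [/wl|/ltW a0] := leP 0 a; first exact.
  have -> : a *: x = (- a) *: (- x) by rewrite scalerN scaleNr opprK.
  by apply: wl; rewrite ?oppr_ge0 ?normrN //; exact: sK.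
wlog b0 : b y / 0 <= b => [wl ab Kx Ky|].
  have [/wl|/ltW b0] := leP 0 b; first exact.
  have -> : b *: y = (- b) *: (- y) by rewrite scalerN scaleNr opprK.
  by apply: wl; rewrite ?oppr_ge0 ?normrN //; exact: sK.
rewrite !ger0_norm // => ab Kx Ky.
have [ab0|ab0] := eqVneq (a + b) 0.
  have -> : a = 0 by lra.
  by rewrite scale0r add0r; apply: centered_scale => //; rewrite ger0_norm //; lra.
have -> : a *: x + b *: y = (a + b) *: ((1 - b / (a + b)) *: x + (b / (a + b)) *: y).
  by apply/rowP => i; rewrite !mxE; field.
have ab_gt0 : 0 < a + b by rewrite lt_neqAle eq_sym ab0 addr_ge0.
apply: centered_scale => //; first by rewrite ger0_norm // ltW.
apply: vK => //; apply/andP; split; first by rewrite divr_ge0 ?(ltW ab_gt0).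
by rewrite ler_pdivrMr // mul1r; lra.
Qed.

(** * The slab parallelogram and the parallelogram around the outer ellipse *)

(** The quadratic expression is a (a + g b) + b (b + g a) <= a + b, so 1 <= m (a + b); adding the
    two slab conditions gives (a + b) (1 + g) <= 2. *)
Lemma contact_angle (R : realType) (m a b g : R) :
  0 < m -> 0 <= a -> 0 <= b -> a + g * b <= 1 -> b + g * a <= 1 ->
  m * (a ^+ 2 + b ^+ 2 + 2 * g * a * b) = 1 -> g <= 2 * m - 1.
Proof.
move=> m0 a0 b0 h1 h2 E.
have ab : 1 <= m * (a + b).
  by rewrite -E ler_pM2l //; nra.
have : (a + b) * (1 + g) <= 2 by lra.
have : 0 < a + b by nra.
nra.
Qed.

(* The corner of the slabs touching at [u] and [v] is close to the outer contact
   point [p] lying between them. *)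
Lemma slab_corner (R : realType) (K : set 'rV[R]_2) f m u v p a b t :
  centered_body K -> 0 < m -> squeezes K f m -> 2 * m - 1 <= 5^-1 ->
  `|bform f u v / m| <= 2 * m - 1 ->
  boundary K u -> qform f u = m -> boundary K v -> qform f v = m ->
  K p -> qform f p = 1 -> 0 < a -> 0 < b -> p = a *: u + b *: v ->
  0 < t -> 10 * (2 * m - 1) ^+ 2 <= t ^+ 2 ->
  K ((1 + t)^-1 *: ((1 + bform f u v / m)^-1 *: (u + v))).
Proof.
move=> bK m0 sf m1 gm bu qu bv qv Kp qp a0 b0 pE t0 ht.
have [_ sK vK _] := bK.
set g := bform f u v / m in gm *.
have uvE : bform f u v = m * g by rewrite /g mulrC divfK ?gt_eqF.
have up : bform f u p = m * (a + g * b).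
  by rewrite pE bformDr !bformZr uvE -/(qform f u) qu; ring.
have vp : bform f v p = m * (b + g * a).
  by rewrite pE bformDr !bformZr bformC uvE -/(qform f v) qv; ring.
have slab w x : boundary K w -> qform f w = m -> K x -> `|bform f w x| <= m.
  move=> bw qw Kx; rewrite ler_norml lerNl -bformNr.
  by rewrite !(inner_contact_slab bK m0 sf bw qw) //; exact: sK.
have := slab u p bu qu Kp; have := slab v p bv qv Kp.
rewrite up vp !normrM (gtr0_norm m0) !ger_pMr // !ler_norml.
move=> /andP[hb1 hb2] /andP[ha1 ha2].
have E : m * (a ^+ 2 + b ^+ 2 + 2 * g * a * b) = 1.
  by rewrite -[X in _ = X]qp pE qform_comb qu qv uvE; ring.
have m2 : 1 <= 2 * m by have := le_trans (normr_ge0 g) gm; rewrite subr_ge0.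
have la : 1 - 2 * (2 * m - 1) <= a + g * b.
  by apply: contact_bound => //; [exact: ltW|apply/andP; split].
have lb : 1 - 2 * (2 * m - 1) <= b + g * a.
  apply: contact_bound => //; [exact: ltW|by apply/andP; split|].
  by rewrite -[X in _ = X]E; ring.
have := @slab_vertex_bound _ (2 * m - 1) a b g m1 gm.
rewrite la lb ha2 hb2 => /(_ isT isT) vb.
set c := (1 + g)^-1 in vb *.
set d := c *: (u + v) - p.
have qd : qform f d <= m * t ^+ 2.
  have -> : d = (c - a) *: u + (c - b) *: v.
    by rewrite /d pE; apply/rowP => i; rewrite !mxE; ring.
  rewrite qform_comb qu qv uvE; apply: le_trans (_ : m * (10 * (2 * m - 1) ^+ 2) <= _).
    have -> : (c - a) ^+ 2 * m + (c - b) ^+ 2 * m + 2 * (c - a) * (c - b) * (m * g) =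
      m * ((c - a) ^+ 2 + (c - b) ^+ 2 + 2 * g * (c - a) * (c - b)) by ring.
    by rewrite ler_pM2l.
  by rewrite ler_pM2l.
have Kd : K (t^-1 *: d).
  apply: (squeezes_sub bK m0 sf).
  by rewrite qformZ exprVn mulrC ler_pdivrMr ?exprn_gt0.
have t1 : 0 < 1 + t by rewrite addr_gt0.
(* The shrunk corner is a convex combination of [p] and [t^-1 *: d], both in [K]. *)
have -> : (1 + t)^-1 *: (c *: (u + v)) = (1 - t / (1 + t)) *: p + (t / (1 + t)) *: (t^-1 *: d).
  rewrite /d; apply/rowP => i; rewrite !mxE; field.
  by rewrite !gt_eqF.
apply: vK => //.
apply/andP; split; first by rewrite ltW // divr_gt0.
by rewrite ler_pdivrMr // mul1r lerDr.
Qed.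


(** In q-orthonormal coordinates {q <= 1} is the unit disc; q is at most 2 on the square around it,
    which is therefore inside sqrt (2 / m) times {q <= m}. *)
Lemma ellipse_ratio_bound (R : realType) (K P : set 'rV[R]_2) z f m c :
  parallelogram P -> (c%:E <= banach_mazur K P)%E ->
  centered_body [set x | K (z + x)] -> 0 < m ->
  squeezes [set x | K (z + x)] f m -> c <= Num.sqrt (2 / m).
Proof.
move=> PP bm bK m0 sf; have [f1 f0 fm] := sf.
have pos x : x != 0 -> 0 < qform f x by exact: squeezes_gt0 bK m0 fm.
pose e : 'rV[R]_2 := \row_i (i == 0)%:R.
(* A vector q-orthogonal to [e]: Gram-Schmidt without division. *)
pose e' : 'rV[R]_2 := \row_i (if i == 0 then - f 0 1 else f 0 0).
have e_neq0 : e != 0.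
  by apply/eqP => /rowP/(_ 0); rewrite !mxE /= => /eqP; rewrite oner_eq0.
have f00 : 0 < f 0 0.
  have <- : qform f e = f 0 0 by rewrite /qform /bform !mxE /=; ring.
  exact: pos.
have e'_neq0 : e' != 0.
  by apply/eqP => /rowP/(_ 1); rewrite !mxE /= => h; rewrite h ltxx in f00.
have qe := pos e e_neq0; have qe' := pos e' e'_neq0.
have ee' : bform f e e' = 0 by rewrite /bform !mxE /=; ring.
pose w1 := (Num.sqrt (qform f e))^-1 *: e.
pose w2 := (Num.sqrt (qform f e'))^-1 *: e'.
have q1 : qform f w1 = 1.
  by rewrite qformZ exprVn sqr_sqrtr ?mulVf ?gt_eqF // ltW.
have q2 : qform f w2 = 1.
  by rewrite qformZ exprVn sqr_sqrtr ?mulVf ?gt_eqF // ltW.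
have q12 s t : qform f (s *: w1 + t *: w2) = s ^+ 2 + t ^+ 2.
  by rewrite qform_comb q1 q2 /w1 /w2 bformZr bformC bformZr bformC ee' !mulr0 addr0 !mulr1.
have w12 : cross w1 w2 != 0.
  have -> : cross w1 w2 = (Num.sqrt (qform f e))^-1 * (Num.sqrt (qform f e'))^-1 * f 0 0.
    by rewrite /cross !mxE /=; ring.
  by rewrite !mulf_neq0 ?invr_eq0 ?gt_eqF ?sqrtr_gt0.
have r0 : 0 < Num.sqrt (2 / m) by rewrite sqrtr_gt0 divr_gt0.
apply: (banach_mazur_le (z := z) PP bm w12 r0) => [x Kx|s t s1 t1].
  have xE := cross_basis x w12.
  set s := _ / _ in xE; set t := (cross w1 x / _) in xE.
  exists s, t; have := f1 x Kx; rewrite {1}xE q12 => st.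
  have one (y : R) : y ^+ 2 <= 1 -> `|y| <= 1.
    by move=> y1; rewrite ler_norml; apply/andP; split; nra.
  by split => //; apply: one; have := sqr_ge0 s; have := sqr_ge0 t; lra.
apply: (squeezes_sub bK m0 sf).
rewrite qformZ q12 exprVn sqr_sqrtr ?divr_ge0 ?(ltW m0) // invf_div.
rewrite mulrAC ler_pdivrMr // ler_pM2l //.
have one (y : R) : `|y| <= 1 -> y ^+ 2 <= 1.
  by rewrite ler_norml => /andP[? ?]; nra.
by have := one s s1; have := one t t1; lra.
Qed.

(** Used for the pairs [u], [v] and [u], [- v], this bounds q(u, v) / m on both sides. *)
Lemma contact_angle_form (R : realType) (K : set 'rV[R]_2) f m u v p a b :
  centered_body K -> 0 < m -> squeezes K f m ->
  boundary K u -> qform f u = m -> boundary K v -> qform f v = m ->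
  K p -> qform f p = 1 -> 0 < a -> 0 < b -> p = a *: u + b *: v ->
  bform f u v / m <= 2 * m - 1.
Proof.
move=> bK m0 sf bu qu bv qv Kp qp a0 b0 pE.
set g := bform f u v / m.
have uvE : bform f u v = m * g by rewrite /g mulrC divfK ?gt_eqF.
apply: (@contact_angle _ m a b g m0 (ltW a0) (ltW b0)).
- have := inner_contact_slab bK m0 sf bu qu Kp.
  have -> : bform f u p = m * (a + g * b).
    by rewrite pE bformDr !bformZr uvE -/(qform f u) qu; ring.
  by rewrite ger_pMr.
- have := inner_contact_slab bK m0 sf bv qv Kp.
  have -> : bform f v p = m * (b + g * a).
    by rewrite pE bformDr !bformZr bformC uvE -/(qform f v) qv; ring.
  by rewrite ger_pMr.
- by rewrite -[X in _ = X]qp pE qform_comb qu qv uvE; ring.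
Qed.

(** The corners of the slab parallelogram are controlled by [slab_corner]. The parameter [t] stays
    free: a rational value can replace the square root, and arbitrarily small values serve when
    [2 * m = 1]. *)
Lemma slab_parallelogram_bound (R : realType) (K P : set 'rV[R]_2) z f m c :
  parallelogram P -> (c%:E <= banach_mazur K P)%E ->
  centered_body [set x | K (z + x)] -> 0 < m -> 2 * m - 1 <= 5^-1 ->
  squeezes [set x | K (z + x)] f m ->
  (forall f' m', squeezes [set x | K (z + x)] f' m' -> m' <= m) ->
  1 <= 2 * m /\
  forall t, 0 < t -> 10 * (2 * m - 1) ^+ 2 <= t ^+ 2 -> c <= 1 + t.
Proof.
move=> PP bm bK m0 m1 sf opt; have [_ sK _ _] := bK.
have [|u [v [p [q [uv [bu qu] [bv qv] [Kp [qp ex1]] [Kq [qq ex2]]]]]]] :=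
  alternating_contacts bK _ sf opt; first by rewrite m0 /=; lra.
have [a [b [a0 b0 pE]]] := ex1; have [a' [b' [a'0 b'0 qE]]] := ex2.
have bNv := boundaryN bK bv; have qNv : qform f (- v) = m by rewrite qformN.
set g := bform f u v / m.
have gN : bform f u (- v) / m = - g by rewrite bformNr mulNr.
have g1 : g <= 2 * m - 1.
  exact: contact_angle_form bK m0 sf bu qu bv qv Kp qp a0 b0 pE.
have g2 : - g <= 2 * m - 1.
  by rewrite -gN; exact: contact_angle_form bK m0 sf bu qu bNv qNv Kq qq a'0 b'0 qE.
split; first lra.
move=> t t0 ht.
have gm : `|g| <= 2 * m - 1 by rewrite ler_norml lerNl g1 g2.
have V1 := slab_corner bK m0 sf m1 gm bu qu bv qv Kp qp a0 b0 pE t0 ht.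
have := @slab_corner _ _ f m u (- v) q a' b' t bK m0 sf m1.
rewrite gN normrN => /(_ gm bu qu bNv qNv Kq qq a'0 b'0 qE t0 ht) V2.
rewrite -/g in V1.
(* Up to the factor [m] this is the q-dual basis of [u], [v]: the coordinates of x are q(u, x) / m
   and q(v, x) / m, and the corners are +-(w1 + w2) and +-(w1 - w2). *)
pose w1 := (1 - g ^+ 2)^-1 *: (u - g *: v).
pose w2 := (1 - g ^+ 2)^-1 *: (v - g *: u).
have [ga gb] : 0 < 1 + g /\ 0 < 1 - g by split; lra.
have g2_gt0 : 0 < 1 - g ^+ 2 by nra.
have uvE : bform f u v = m * g by rewrite /g mulrC divfK ?gt_eqF.
have w12 : cross w1 w2 != 0.
  have -> : cross w1 w2 = (1 - g ^+ 2)^-1 * cross u v.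
    by rewrite /cross !mxE; field; rewrite gt_eqF.
  by rewrite mulf_neq0 // invr_eq0 gt_eqF.
have t1 : 0 < 1 + t by rewrite addr_gt0.
have slab w x : boundary [set x | K (z + x)] w -> qform f w = m -> K (z + x) ->
    `|bform f w x / m| <= 1.
  move=> bw qw Kx; rewrite ler_norml ler_pdivlMr // ler_pdivrMr // mul1r mulN1r.
  rewrite lerNl -bformNr.
  by rewrite !(inner_contact_slab bK m0 sf bw qw) //; exact: sK.
apply: (banach_mazur_le (z := z) PP bm w12 t1) => [x Kx|s r s1 r1].
  exists (bform f u x / m), (bform f v x / m); split; try exact: slab.
  have xE := cross_basis x uv.
  set k := _ / _ in xE; set l := (cross u x / _) in xE.
  rewrite {2 3}xE !bformDr !bformZr [bform f v u]bformC uvE -/(qform f u) -/(qform f v) qu qv.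
  rewrite [LHS]xE /w1 /w2; apply/rowP => i; rewrite !mxE; field.
  by rewrite !gt_eqF.
(* In terms of two adjacent corners, the absolute values of the coefficients sum to the maximum of
   |s| and |r|. *)
have /= := @centered_comb _ [set x | K (z + x)] _ _ ((s + r) / 2) ((s - r) / 2) bK _ V1 V2.
have -> : (1 + t)^-1 *: (s *: w1 + r *: w2) =
   (s + r) / 2 *: ((1 + t)^-1 *: ((1 + g)^-1 *: (u + v))) +
   (s - r) / 2 *: ((1 + t)^-1 *: ((1 - g)^-1 *: (u - v))).
  rewrite /w1 /w2; apply/rowP => i; rewrite !mxE; field.
  by rewrite !gt_eqF.
apply.
move: s1 r1; rewrite !ler_norml => /andP[? ?] /andP[? ?].
by case: (ger0P ((s + r) / 2)) => ?; case: (ger0P ((s - r) / 2)) => ?; lra.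
Qed.

(** * Numerical conclusion *)

Lemma sqrt_ratio_lt (R : realType) (m eps : R) :
  0 < m -> 0 < 1 - eps / 10 -> 1 < 2 * m * (1 - eps / 10) ^+ 2 ->
  Num.sqrt m^-1 < Num.sqrt 2 * (1 - eps / 10).
Proof.
move=> m0 e0 h.
rewrite -(@ltr_pXn2r _ 2) ?nnegrE ?mulr_ge0 ?sqrtr_ge0 ?(ltW e0) //.
rewrite exprMn !sqr_sqrtr ?invr_ge0 ?(ltW m0) //.
by rewrite -[m^-1]mul1r ltr_pdivrMr // mulrAC.
Qed.

Theorem theorem1p3 (R : realType) (K P : set 'rV[R]_2) (eps : R) :
  convex_body K -> point_symmetric K -> parallelogram P -> 0 < eps ->
  ((1 + eps)%:E <= banach_mazur K P)%E ->
  (alpha1 K < (Num.sqrt 2 * (1 - eps / 10))%:E)%E.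
Proof.
move=> cK sK PP e0 bm.
have [z bK] := convex_body_centered cK sK.
have [f [m [m0 sf opt]]] := optimal_squeeze bK.
apply: (le_lt_trans (alpha1_le bK m0 sf)); rewrite lte_fin.
have [m1|m1] := lerP (2 * m - 1) 5^-1; last first.
  have h := ellipse_ratio_bound PP bm bK m0 sf.
  have h2 : (1 + eps) ^+ 2 * m <= 2.
    rewrite -ler_pdivlMr // -[leRHS]sqr_sqrtr ?divr_ge0 ?(ltW m0) //.
    by rewrite ler_pXn2r ?nnegrE ?sqrtr_ge0 // addr_ge0 // ltW.
  (* Here 2 / m < 10/3 < (11/6)^2, hence eps < 5/6; the conclusion follows from (6/5) (11/12)^2 >
     1. *)
  have : (1 + eps) ^+ 2 < (11 / 6) ^+ 2.
    have X0 : 0 < (1 + eps) ^+ 2 by rewrite exprn_gt0 // addr_gt0.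
    have : (1 + eps) ^+ 2 * (6 / 5) < (1 + eps) ^+ 2 * (2 * m).
      by rewrite ltr_pM2l //; lra.
    lra.
  rewrite ltr_pXn2r // ?nnegrE; [|lra|lra] => e1.
  apply: sqrt_ratio_lt => //; first lra.
  have : (11 / 12) ^+ 2 <= (1 - eps / 10) ^+ 2 by rewrite ler_pXn2r // ?nnegrE; lra.
  nra.
have [m2 h] := slab_parallelogram_bound PP bm bK m0 m1 sf opt.
have [m3|m3] := eqVneq (2 * m - 1) 0.
  (* Since [t] has to be positive, this case takes eps / 2, which contradicts [1 + eps <= 1 + t]. *)
  have := h (eps / 2); rewrite m3 expr0n mulr0 sqr_ge0 => /(_ _ isT) H.
  by have := H ltac:(lra); lra.
have c0 : 0 < 2 * m - 1 by rewrite lt_neqAle eq_sym m3 subr_ge0.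
(* The factor 4 is a rational number above sqrt 10. *)
have h1 : eps <= 4 * (2 * m - 1).
  have := h (4 * (2 * m - 1)) ltac:(lra) ltac:(nra); lra.
set c := 2 * m - 1 in m1 c0 h1.
apply: sqrt_ratio_lt => //; first by lra.
have -> : 2 * m = 1 + c by rewrite /c; ring.
(* It remains that (1 + c) (1 - 2c/5)^2 > 1 for 0 < c <= 1/5. *)
have : (1 - 2 / 5 * c) ^+ 2 <= (1 - eps / 10) ^+ 2.
  by rewrite ler_pXn2r // ?nnegrE; lra.
nra.
Qed.
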